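(* Let $b\ge2$ be an integer, $\gamma\in(0,1)$, and let $\phi$ be a real analytic $\mathbb{Z}$-periodic function satisfying condition (H) (for all $\mathbf{i}\neq\mathbf{j}\in\Sigma$, $x\mapsto S(x,\mathbf{j})-S(x,\mathbf{i})$ is not identically zero on $[0,1]$). Then there exist $\ell_0\in\mathbb{N}$ and $\varepsilon_0>0$ such that for Lebesgue-a.e. $x\in[0,1]$ the following holds: for every integer $\ell\ge\ell_0$ there exists a set $Q_{x,\ell}\subset\mathbb{Z}_+$ such that (i) $Q_{x,\ell}$ is infinite; (ii) for every $\mathbf{w}\in\Lambda^{\ell}$ and every $n\in Q_{x,\ell}$, any two distinct points $p\neq q$ of $X^{\mathbf{w},x}_{\hat n}$ satisfy $|p-q|>\varepsilon_0^{\hat n}$, where $X^{\mathbf{w},x}_{N}=\{S(x,\mathbf{j}\mathbf{w}):\mathbf{j}\in\Lambda^{N-\ell}\}$ for $N>\ell$ and $X^{\mathbf{w},x}_N=\{0\}$ for $N\le\ell$.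
   Context: $\Lambda=\{0,\dots,b-1\}$, $\Sigma=\Lambda^{\mathbb{Z}_+}$. For a word $\mathbf{j}=j_1\cdots j_p$ of length $1\le p\le\infty$ and $x\in[0,1]$, $S(x,\mathbf{j})=\sum_{n=1}^{p}\gamma^{n-1}\phi\big(\frac{x+j_1+j_2b+\cdots+j_nb^{n-1}}{b^n}\big)$; $\mathbf{j}\mathbf{w}$ denotes concatenation of words. For $n\in\mathbb{N}$, $\hat n$ is the unique integer with $\gamma^{\hat n}\le b^{-n}<\gamma^{\hat n-1}$. *)

(* Defs.v *)
From HB Require Import structures.
From mathcomp Require Import all_boot all_order all_algebra.
From mathcomp Require Import all_classical all_reals all_analysis.
Set Implicit Arguments. Unset Strict Implicit. Unset Printing Implicit Defensive.
Import Order.TTheory GRing.Theory Num.Theory numFieldNormedType.Exports.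
Local Open Scope classical_set_scope.
Local Open Scope ring_scope.

Section Defs.
Variable R : realType.

Definition real_analytic (f : R -> R) : Prop :=
  forall x0 : R, exists (a : nat -> R) (r : R), 0 < r /\
    forall x : R, `|x - x0| < r ->
      (fun n : nat => \sum_(0 <= k < n) a k * (x - x0) ^+ k) @ \oo --> f x.

Definition Zperiodic (f : R -> R) : Prop := forall x : R, f (x + 1) = f x.

(* n-th term (0-indexed, i.e. paper's index n+1) of S(x, j) for a word
   given by its digit function j (j 0 = j_1, j 1 = j_2, ...) *)
Definition Sterm (b : nat) (gamma : R) (phi : R -> R) (x : R)
  (j : nat -> 'I_b) (n : nat) : R :=
  gamma ^+ n * phi ((x + \sum_(k < n.+1) (j k)%:R * (b%:R) ^+ k) / (b%:R) ^+ n.+1).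

Definition Sfin (b : nat) (gamma : R) (phi : R -> R) (x : R)
  (j : seq 'I_b) : R :=
  \sum_(0 <= n < size j)
    gamma ^+ n * phi ((x + \sum_(k < n.+1) (nth 0%N (map val j) k)%:R * (b%:R) ^+ k)
                       / (b%:R) ^+ n.+1).

Definition Sinf (b : nat) (gamma : R) (phi : R -> R) (x : R)
  (j : nat -> 'I_b) : R :=
  limn (series (Sterm gamma phi x j)).

Definition condH (b : nat) (gamma : R) (phi : R -> R) : Prop :=
  forall i j : nat -> 'I_b, i <> j ->
    ~ (forall x : R, 0 <= x <= 1 -> Sinf gamma phi x j - Sinf gamma phi x i = 0).

Definition Xset (b : nat) (gamma : R) (phi : R -> R) (l : nat)
  (w : seq 'I_b) (x : R) (N : nat) : set R :=
  if (l < N)%N then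
    [set y | exists j : seq 'I_b, size j = (N - l)%N /\ y = Sfin gamma phi x (j ++ w)]
  else [set 0].

End Defs.

(* Main.v *)
Require Import Defs.
From HB Require Import structures.
From mathcomp Require Import all_boot all_order all_algebra.
From mathcomp Require Import all_classical all_reals all_analysis.
From mathcomp Require Import ring lra zify.
Import Order.TTheory GRing.Theory Num.Theory numFieldNormedType.Exports.
Local Open Scope classical_set_scope.
Local Open Scope ring_scope.

(* Newton interpolation in divided-difference form drives everything.  Power
   series and compactness give [|phi[x_0, ..., x_m]| <= M kappa^m] for distinct
   points in any interval of a fixed small length; this bound is stable under
   sums, contractions and pointwise limits, so it holds uniformly for all
   differences [F = S(., v) - S(., v')].  Interpolating [F] at many points where
   it is small shows that [F] is small on the whole interval.  Hence a limit of
   such [F] vanishing on an interval vanishes identically, and by compactness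
   of the space of words (H) bounds [sup |F|] below on each interval, uniformly
   over long words with distinct first letters; a second use of interpolation
   covers [{|F| <= c0 eta^m}] by boundedly many intervals of radius [eta].  If
   two words first differ at position [t], then [S(x, v) - S(x, v')] is
   [gamma^t F(y)] with [y] affine in [x], so summing over all pairs of words and
   applying Borel-Cantelli gives separation for almost every [x] and all large
   [n]. *)

Set Implicit Arguments.
Unset Strict Implicit.
Unset Printing Implicit Defensive.

(** * Divided differences and the Newton interpolation bound *)

Section DividedDifferences.
Variable R : realType.
Implicit Types (F G : R -> R) (s : seq R) (x y z c t e M kappa : R).

(* [diffq F x] takes the junk value 0 at [x], whence the [uniq] hypotheses below. *)
Definition diffq F x z := (F z - F x) / (z - x).

(** The nodes of [s] are consumed from the left, so [divdiff F s y] is the classical divided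
    difference at the points of [s] followed by [y], of order [size s]. *)
Definition divdiff F s := foldl diffq F s.

(** Quantifying over the centre [c] makes the class invariant under translations, so that one triple
    of constants serves on every interval of radius [e]. *)
Definition divdiff_bounded M kappa e F := forall c s y,
  uniq (y :: s) -> (forall x, x \in y :: s -> `|x - c| <= e) ->
  `|divdiff F s y| <= M * kappa ^+ size s.

Lemma divdiffD F G s : divdiff (F \+ G) s = divdiff F s \+ divdiff G s.
Proof.
elim: s F G => [//|x s IH] F G /=.
rewrite -IH; congr divdiff; apply/funext => z /=.
by rewrite /diffq /= -mulrDl; congr (_ / _); ring.
Qed.

Lemma divdiffZ a F s : divdiff (fun x => a * F x) s = (fun x => a * divdiff F s x).
Proof.
elim: s F => [//|x s IH] F /=.
rewrite -IH; congr divdiff; apply/funext => z /=.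
by rewrite /diffq -mulrBr mulrA.
Qed.

Lemma divdiff_affine a t F s y : a != 0 ->
  divdiff (fun x => F (a * x + t)) s y =
  a ^+ size s * divdiff F [seq a * x + t | x <- s] (a * y + t).
Proof.
move=> a0; elim: s F => [|x s IH] F /=; first by rewrite expr0 mul1r.
rewrite exprSr.
rewrite (_ : diffq (fun x => F (a * x + t)) x =
    (fun z => a * diffq F (a * x + t) (a * z + t))).
  by rewrite divdiffZ IH mulrA [a * _]mulrC.
apply/funext => z; rewrite /diffq.
rewrite (_ : a * z + t - (a * x + t) = a * (z - x)); last by ring.
by rewrite invfM mulrCA mulVKf.
Qed.

(** A divided difference is a fixed finite combination of values at the nodes, so pointwise
    convergence suffices. *)
Lemma divdiff_cvg (Fn : nat -> R -> R) F s y : uniq (y :: s) ->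
  (forall x, x \in y :: s -> Fn n x @[n --> \oo] --> F x) ->
  divdiff (Fn n) s y @[n --> \oo] --> divdiff F s y.
Proof.
elim: s Fn F => [|x s IH] Fn F; first by move=> _; apply; exact: mem_head.
rewrite /= inE negb_or => /andP[/andP[yx ys] /andP[xs us]] FG.
apply: (IH (fun n => diffq (Fn n) x)) => /=; first by rewrite ys us.
move=> z zs; rewrite /diffq; apply: cvgM; last exact: cvg_cst.
by apply: cvgB; apply: FG; rewrite !inE ?eqxx ?orbT//;
  move: zs; rewrite inE => /orP[->|->]; rewrite ?orbT.
Qed.

Lemma divdiff_bounded0 kappa e : divdiff_bounded 0 kappa e (fun=> 0).
Proof.
move=> c s y _ _; rewrite mul0r.
have -> : (fun=> 0 : R) = (fun x : R => 0 * 0 : R).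
  by apply/funext => z; rewrite mul0r.
by rewrite divdiffZ mul0r normr0.
Qed.

Lemma divdiff_boundedD M1 M2 kappa e F G : divdiff_bounded M1 kappa e F ->
  divdiff_bounded M2 kappa e G -> divdiff_bounded (M1 + M2) kappa e (F \+ G).
Proof.
move=> HF HG c s y us near; rewrite divdiffD mulrDl.
by apply: le_trans (ler_normD _ _) (lerD (HF c s y us near) (HG c s y us near)).
Qed.

Lemma divdiff_boundedZ a M kappa e F : divdiff_bounded M kappa e F ->
  divdiff_bounded (`|a| * M) kappa e (fun x => a * F x).
Proof.
move=> HF c s y us near; rewrite divdiffZ normrM -mulrA.
by apply: ler_wpM2l => //; exact: HF us near.
Qed.

(** A contraction sends an interval of radius [e] into one of radius at most [e], and the factor
    [a ^+ size s] is at most 1, so no constant deteriorates. *)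
Lemma divdiff_bounded_affine a t M kappa e F : 0 < a <= 1 -> 0 <= M -> 0 <= kappa ->
  divdiff_bounded M kappa e F -> divdiff_bounded M kappa e (fun x => F (a * x + t)).
Proof.
move=> /andP[a0 a1] M0 k0 HF c s y us near.
have an0 : a != 0 by rewrite gt_eqF.
rewrite divdiff_affine// normrM normrX (ger0_norm (ltW a0)).
have inj : injective (fun x => a * x + t) by move=> u v /addIr /(mulfI an0).
have := HF (a * c + t) [seq a * x + t | x <- s] (a * y + t).
rewrite -(map_cons (fun x => a * x + t) y s) (map_inj_uniq inj) size_map.
move=> /(_ us) H.
apply: (@le_trans _ _ (1 * `|divdiff F [seq a * x + t | x <- s] (a * y + t)|)).
  by apply: ler_wpM2r => //; rewrite exprn_ile1// ltW.
rewrite mul1r; apply: H => // _ /mapP[x xs ->].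
rewrite (_ : _ - _ = a * (x - c)); last by ring.
rewrite normrM (ger0_norm (ltW a0)) (le_trans _ (near x xs))//.
by rewrite ler_piMl.
Qed.

Lemma divdiff_bounded_cvg M kappa e (Fn : nat -> R -> R) F :
  (forall n, divdiff_bounded M kappa e (Fn n)) ->
  (forall x, Fn n x @[n --> \oo] --> F x) -> divdiff_bounded M kappa e F.
Proof.
move=> HF cF c s y us near.
have cv : divdiff (Fn n) s y @[n --> \oo] --> divdiff F s y by apply: divdiff_cvg.
have /cvg_norm cv' := cv.
rewrite -(cvg_lim (@Rhausdorff R) cv'); apply: limr_le; first by apply/cvg_ex; eexists; exact: cv'.
by apply: nearW => n; exact: HF us near.
Qed.

Lemma divdiff_boundedW M M' kappa kappa' e e' F : 0 <= M <= M' ->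
  0 <= kappa <= kappa' -> e' <= e ->
  divdiff_bounded M kappa e F -> divdiff_bounded M' kappa' e' F.
Proof.
move=> /andP[M0 MM] /andP[k0 kk] ee HF c s y us near.
apply: le_trans (HF c s y us _) _.
  by move=> x xs; apply: le_trans (near x xs) ee.
by apply: ler_pM => //; rewrite ?exprn_ge0// lerXn2r// nnegrE// (le_trans k0).
Qed.

(** Newton's formula with remainder, one node at a time: [F y = F x + (y - x) * diffq F x y], and
    the induction hypothesis bounds [diffq F x] from the remaining nodes. *)
Lemma newton_bound F s y L delta eta : 0 < eta <= 1 -> 0 <= L <= 1 -> 0 <= delta ->
  pairwise (fun u v => eta <= `|u - v|) s -> y \notin s ->
  (forall u v, u \in y :: s -> v \in y :: s -> `|u - v| <= L) ->
  (forall u, u \in s -> `|F u| <= delta) ->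
  `|F y| <= delta * (size s)%:R * (2 / eta) ^+ size s + L ^+ size s * `|divdiff F s y|.
Proof.
move=> /andP[eta0 eta1] /andP[L0 L1].
elim: s F delta => [|x s IH] F delta d0; first by rewrite /= mulr0 mul0r expr0 mul1r add0r.
rewrite pairwise_cons inE negb_or => /andP[/allP xs pw] /andP[yx ys] HL Fs.
have yx0 : y - x != 0 by rewrite subr_eq0.
have e2 : 1 <= 2 / eta.
  by rewrite ler_pdivlMr// mul1r (le_trans eta1)// ler1n.
have sub : {subset y :: s <= [:: y, x & s]}.
  by move=> u; rewrite !inE => /orP[->//|->]; rewrite !orbT.
(* At the remaining nodes, [eta]-separated from [x], the quotient is at most [2 * delta / eta]: each
   node costs one factor [2 / eta]. *)
have : `|diffq F x y| <= 2 * delta / eta * (size s)%:R * (2 / eta) ^+ size s +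
  L ^+ size s * `|divdiff (diffq F x) s y|.
  apply: IH => //.
  - by rewrite divr_ge0 ?(ltW eta0)// mulr_ge0.
  - by move=> u v us vs; apply: HL; apply: sub.
  - move=> u us; rewrite /diffq normrM normfV.
    have := xs u us; rewrite distrC => exu.
    have Fu := Fs u; rewrite inE us orbT in Fu.
    have Fx := Fs x (mem_head _ _).
    apply: ler_pM => //.
      apply: le_trans (ler_normB _ _) _; rewrite mulr_natl mulr2n.
      by apply: lerD => //; exact: Fu.
    by rewrite lef_pV2// posrE (lt_le_trans eta0).
move=> H.
have -> : F y = F x + (y - x) * diffq F x y by rewrite /diffq mulrC divfK// addrC subrK.
apply: le_trans (ler_normD _ _) _; rewrite normrM.
have Fx := Fs x (mem_head _ _).
have yL : `|y - x| <= L by apply: HL; rewrite !inE eqxx ?orbT.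
have A : `|y - x| * `|diffq F x y| <= L * (2 * delta / eta * (size s)%:R * (2 / eta) ^+ size s +
  L ^+ size s * `|divdiff (diffq F x) s y|) by apply: ler_pM.
apply: le_trans (lerD Fx A) _.
rewrite mulrDr addrA [L * (L ^+ _ * _)]mulrA -exprS; apply: lerD => //=.
(* The extra unit in [(size s).+1] absorbs the term [F x]; the factor [L] on the other part is
   replaced by 1. *)
have -> : delta * (size s).+1%:R * (2 / eta) ^+ (size s).+1 =
  delta * (2 / eta) ^+ (size s).+1 +
    1 * (2 * delta / eta * (size s)%:R * (2 / eta) ^+ size s).
  by rewrite exprS -natr1; ring.
apply: lerD; first by rewrite ler_peMr// exprn_ege1.
apply: ler_wpM2r => //.
rewrite !mulr_ge0// ?invr_ge0 ?(ltW eta0)// exprn_ge0//.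
by rewrite (le_trans _ e2).
Qed.

End DividedDifferences.

(** * Uniform divided-difference bounds for periodic analytic functions *)

Section AnalyticBounds.
Variable R : realType.
Implicit Types (F : R -> R) (s : seq R) (x y z c t e M kappa rho : R).

Lemma sum_half_pow n : \sum_(k < n) (2^-1 : R) ^+ k = 2 - 2 * 2^-1 ^+ n.
Proof.
elim: n => [|n IH]; first by rewrite big_ord0 expr0; lra.
by rewrite big_ord_recr /= IH exprS; lra.
Qed.

(** With truncated subtraction the closed form also covers [n <= i.+1], where both sides are 0. *)
Lemma sum_half_pow_above i n :
  \sum_(k < n | (i < k)%N) (2^-1 : R) ^+ (k.-1 - i) = 2 - 2 * 2^-1 ^+ (n.-1 - i).
Proof.
elim: n => [|n IH]; first by rewrite big_ord0 expr0; lra.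
rewrite big_mkcond big_ord_recr -big_mkcond IH /=.
case: ltnP => ni; last first.
  rewrite (_ : (n - i = 0)%N); last lia.
  by rewrite (_ : (n.-1 - i = 0)%N) ?addr0//; lia.
by rewrite (_ : (n - i = (n.-1 - i).+1)%N) ?exprS; [lra | lia].
Qed.

(** Synthetic division by [z - x1]. Since [x1] is within [rho / 2] of [x0], each quotient
    coefficient is dominated by a series of ratio 1/2: the decay rate [rho] survives and only a
    factor [2 / rho] is lost. *)
Lemma poly_quotient n (a : nat -> R) M rho x0 x1 : 0 < rho -> `|x1 - x0| <= rho / 2 ->
  (forall k, `|a k| <= M * rho ^- k) ->
  exists2 g : nat -> R, (forall k, `|g k| <= 2 * M / rho * rho ^- k) &
    forall z, \sum_(k < n) a k * (z - x0) ^+ k - \sum_(k < n) a k * (x1 - x0) ^+ k =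
      (z - x1) * \sum_(k < n) g k * (z - x0) ^+ k.
Proof.
move=> rho0; set t := x1 - x0 => tr Ha.
have M0 : 0 <= M by have := le_trans (normr_ge0 _) (Ha 0%N); rewrite expr0 invr1 mulr1.
exists (fun i => \sum_(k < n | (i < k)%N) a k * t ^+ (k.-1 - i)).
  move=> i; apply: le_trans (ler_norm_sum _ _ _) _.
  apply: (@le_trans _ _ (\sum_(k < n | (i < k)%N) M * rho ^- i.+1 * 2^-1 ^+ (k.-1 - i))).
    apply: ler_sum => k ik; rewrite normrM normrX.
    have H : `|t| ^+ (k.-1 - i) <= (rho / 2) ^+ (k.-1 - i).
      by apply: lerXn2r; rewrite ?nnegrE ?divr_ge0// ltW.
    apply: le_trans (ler_pM _ _ (Ha k) H) _ => //.
    rewrite (_ : nat_of_ord k = (k.-1 - i + i.+1)%N); last lia.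
    rewrite (_ : ((k.-1 - i + i.+1).-1 - i = k.-1 - i)%N); last lia.
    rewrite exprMn exprD; set m := (k.-1 - i)%N.
    have rm : rho ^+ m != 0 by rewrite expf_neq0// gt_eqF.
    have ri : rho ^+ i.+1 != 0 by rewrite expf_neq0// gt_eqF.
    by rewrite le_eqVlt; apply/orP; left; apply/eqP; field; apply/andP.
  rewrite -mulr_sumr sum_half_pow_above.
  apply: (@le_trans _ _ (M * rho ^- i.+1 * 2)).
    apply: ler_wpM2l; first by rewrite mulr_ge0// invr_ge0 exprn_ge0// ltW.
    have : 0 <= (2^-1 : R) ^+ (n.-1 - i) by rewrite exprn_ge0.
    lra.
  have ri : rho ^+ i != 0 by rewrite expf_neq0// gt_eqF.
  have r0 : rho != 0 by rewrite gt_eqF.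
  by rewrite exprS le_eqVlt; apply/orP; left; apply/eqP; field; apply/andP.
move=> z; rewrite -sumrB (_ : z - x1 = (z - x0) - t); last by rewrite /t; ring.
set w := z - x0.
transitivity (\sum_(k < n) \sum_(i < n | (i < k)%N) (w - t) * (a k * t ^+ (k.-1 - i) * w ^+ i)).
  apply: eq_bigr => k _.
  rewrite -mulrBr -opprB subrXX.
  rewrite (big_ord_widen n (fun i => t ^+ (k.-1 - i) * w ^+ i)); last exact: ltnW.
  rewrite mulr_sumr -sumrN mulr_sumr; apply: eq_bigr => i _; ring.
rewrite (exchange_big_dep xpredT)//= mulr_sumr; apply: eq_bigr => i _.
by rewrite -mulr_sumr mulr_suml.
Qed.

(** Taking a difference quotient replaces the polynomial by its quotient, multiplying [M] by
    [2 / rho]. Agreement at the nodes is enough, since the values of [F] elsewhere never enter. *)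
Lemma divdiff_poly_bound n rho x0 s M (a : nat -> R) F y : 0 < rho ->
  uniq (y :: s) -> (forall x, x \in y :: s -> `|x - x0| <= rho / 2) ->
  (forall k, `|a k| <= M * rho ^- k) ->
  (forall z, z \in y :: s -> F z = \sum_(k < n) a k * (z - x0) ^+ k) ->
  `|divdiff F s y| <= 2 * M * (2 / rho) ^+ size s.
Proof.
move=> rho0; elim: s M a F => [|x s IH] M a F.
  move=> _ near Ha HF /=; rewrite HF ?mem_head// expr0 mulr1.
  have M0 : 0 <= M by have := le_trans (normr_ge0 _) (Ha 0%N); rewrite expr0 invr1 mulr1.
  apply: le_trans (ler_norm_sum _ _ _) _.
  apply: (@le_trans _ _ (\sum_(k < n) M * 2^-1 ^+ k)).
    apply: ler_sum => k _; rewrite normrM normrX.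
    have H : `|y - x0| ^+ k <= (rho / 2) ^+ k.
      by apply: lerXn2r; rewrite ?nnegrE ?divr_ge0 ?near ?mem_head// ltW.
    apply: le_trans (ler_pM _ _ (Ha k) H) _ => //.
    by rewrite exprMn mulrA divfK// expf_neq0// gt_eqF.
  rewrite -mulr_sumr sum_half_pow mulrC; apply: ler_wpM2r => //.
  have : 0 <= (2^-1 : R) ^+ n by rewrite exprn_ge0.
  lra.
rewrite /= inE negb_or => /andP[/andP[yx ys] /andP[xs us]] near Ha HF.
have sub : {subset y :: s <= [:: y, x & s]}.
  by move=> u; rewrite !inE => /orP[->//|->]; rewrite !orbT.
have xin : x \in [:: y, x & s] by rewrite !inE eqxx orbT.
have [g Hg gE] := poly_quotient n rho0 (near x xin) Ha.
have := IH (2 * M / rho) g (diffq F x); rewrite /= ys us => /(_ isT) H.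
apply: le_trans (H _ Hg _) _.
- by move=> z /sub; exact: near.
- move=> z zs; rewrite /diffq (HF _ (sub _ zs)) (HF _ xin) gE mulrAC divff ?mul1r//.
  by rewrite subr_eq0; apply: contraTneq zs => ->; rewrite inE negb_or xs eq_sym yx.
- by rewrite exprS le_eqVlt; apply/orP; left; apply/eqP; ring.
Qed.

Lemma analytic_divdiff_local F : real_analytic F -> forall x0, exists M rho,
  [/\ 0 < rho, 0 <= M & forall s y, uniq (y :: s) ->
    (forall x, x \in y :: s -> `|x - x0| <= rho / 2) ->
    `|divdiff F s y| <= 2 * M * (2 / rho) ^+ size s].
Proof.
move=> Fan x0; have [a [r [r0 Fa]]] := Fan x0.
pose rho := r / 2; have rho0 : 0 < rho by rewrite divr_gt0.
have rhor : rho < r by rewrite /rho; lra.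
(* The series converges at [x0 + rho], so its terms are bounded there; this yields the decay of the
   coefficients. *)
have : (fun n => a n * rho ^+ n) @ \oo --> 0.
  apply: cvg_series_cvg_0; apply/cvg_ex; exists (F (x0 + rho)).
  have := Fa (x0 + rho); rewrite (_ : x0 + rho - x0 = rho); last by ring.
  by apply; rewrite gtr0_norm.
move=> /(@cvgP _ _ _) /cvg_seq_bounded [M0 [M0r HM]].
have {}HM := HM (`|M0| + 1) _ _.
exists (`|M0| + 1), rho; split => //.
move=> s y us near.
have Ha k : `|a k| <= (`|M0| + 1) * rho ^- k.
  have rk : 0 < rho ^+ k by rewrite exprn_gt0.
  rewrite ler_pdivlMr// -{1}(gtr0_norm rk) -normrM; apply: HM => //.
  by apply: le_lt_trans (ler_norm _) _; rewrite ltrDl.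
have cv : divdiff (fun z => \sum_(0 <= k < n) a k * (z - x0) ^+ k) s y @[n --> \oo]
    --> divdiff F s y.
  apply: (divdiff_cvg (Fn := fun n z => \sum_(0 <= k < n) a k * (z - x0) ^+ k)) => //.
  move=> x xs; apply: Fa; apply: le_lt_trans (near x xs) _.
  by apply: le_lt_trans rhor; lra.
have /cvg_norm cv' := cv.
rewrite -(cvg_lim (@Rhausdorff R) cv'); apply: limr_le; first by apply/cvg_ex; eexists; exact: cv'.
apply: nearW => n.
by apply: (divdiff_poly_bound (n := n) rho0 us near Ha) => z _; rewrite big_mkord.
Qed.

Lemma analytic_divdiff_bounded F : real_analytic F -> Zperiodic F ->
  exists M kappa e, [/\ 0 < M, 0 < kappa, 0 < e & divdiff_bounded M kappa e F].
Proof.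
move=> Fan Fper.
(* A single index controls [M], [kappa] and the inverse radius, so that compactness of the unit
   interval delivers all three at once. *)
pose P (n : nat) (c : R) := forall s y, uniq (y :: s) ->
  (forall x, x \in y :: s -> `|x - c| <= n.+1%:R^-1) ->
  `|divdiff F s y| <= n.+1%:R * n.+1%:R ^+ size s.
have : \forall n \near \oo, `[0, 1] `<=` P n.
  have := @segment_compact R 0 1; rewrite compact_near_coveringP; apply => x0 _.
  have [M [rho [rho0 M0 H]]] := analytic_divdiff_local Fan x0.
  have r4 : 0 < rho / 4 by rewrite divr_gt0.
  exists ([set x | `|x - x0| < rho / 4],
    [set n | (rho / 4)^-1 <= n.+1%:R /\ 2 * M <= n.+1%:R]).
    split => /=.
      by apply/nbhs_ballP; exists (rho / 4) => //= x; rewrite /ball /= distrC.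
    near=> n; split.
      by apply: (@le_trans _ _ n%:R); [near: n; exact: nbhs_infty_ger | rewrite ler_nat].
    by apply: (@le_trans _ _ n%:R); [near: n; exact: nbhs_infty_ger | rewrite ler_nat].
  move=> [c n] /= [cx0 [n1 n2]] s y us near.
  have n0 : 0 < n.+1%:R :> R by [].
  apply: le_trans (H s y us _) _.
    move=> x xs; rewrite (_ : x - x0 = (x - c) + (c - x0)); last by ring.
    apply: le_trans (ler_normD _ _) _.
    rewrite (_ : rho / 2 = rho / 4 + rho / 4); last by lra.
    apply: lerD; last exact: ltW.
    by apply: le_trans (near x xs) _; rewrite -[leRHS]invrK lef_pV2// posrE invr_gt0.
  have rh : 2 / rho <= n.+1%:R.
    by apply: le_trans n1; rewrite invf_div; rewrite ler_pM2r ?invr_gt0//; lra.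
  have rh0 : 0 <= 2 / rho by rewrite divr_ge0// ltW.
  apply: ler_pM => //; first by rewrite mulr_ge0.
    by rewrite exprn_ge0.
  by apply: lerXn2r; rewrite ?nnegrE.
move=> [n _ /(_ n (leqnn n)) /= Pn].
exists n.+1%:R, n.+1%:R, n.+1%:R^-1; split => // c s y us near.
have Fz (m : nat) x : F (x + m%:R) = F x.
  by elim: m => [|m IH]; rewrite ?addr0// -natr1 addrA Fper.
have FZ (m : int) x : F (x + m%:~R) = F x.
  case: m => m; first exact: Fz.
  by rewrite NegzE mulrNz -[in RHS](subrK m.+1%:R x) Fz.
(* Periodicity moves the centre [c] into the unit interval. *)
have E : F = (fun x => F (1 * x + - (Num.floor c)%:~R)).
  by apply/funext => x; rewrite mul1r -mulrNz FZ.
rewrite E divdiff_affine// expr1n mul1r.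
have /andP[c0 c1] := floor_itv c.
have c01 : (c - (Num.floor c)%:~R) \in `[0, 1].
  by rewrite in_itv /= subr_ge0 c0 lerBlDl ltW// -[1 in ltRHS]/(1%:~R) -intrD.
have := Pn _ c01 [seq x - (Num.floor c)%:~R | x <- s] (y - (Num.floor c)%:~R).
rewrite -(map_cons (fun x => x - (Num.floor c)%:~R) y s) map_inj_uniq; last exact: addIr.
move=> /(_ us); rewrite size_map !mul1r.
rewrite (_ : [seq 1 * x - (Num.floor c)%:~R | x <- s] = [seq x - (Num.floor c)%:~R | x <- s]).
  apply => _ /mapP[x xs ->]; rewrite (_ : _ - _ - _ = x - c); last by ring.
  exact: near.
by apply: eq_map => x; rewrite mul1r.
Unshelve. all: by end_near. Qed.

End AnalyticBounds.

(** * Interpolation from small values; covering sublevel sets *)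

Section SublevelSets.
Variable R : realType.
Implicit Types (F : R -> R) (s : seq R) (x y z a c h eta delta M kappa : R).

Definition coverable (k : nat) eta (A : set R) := exists s : seq R,
  (size s <= k)%N /\ forall y, A y -> exists2 x, x \in s & `|y - x| <= eta.

Lemma coverable_bigcup (T : finType) (A : T -> set R) k eta :
  (forall t, coverable k eta (A t)) ->
  coverable (k * #|T|)%N eta [set y | exists t, A t y].
Proof.
move=> /choice[f Hf]; exists (flatten [seq f t | t <- enum T]); split.
  rewrite size_flatten /shape -map_comp cardE.
  elim: (enum T) => [|t l IH] /=; first by rewrite muln0.
  by rewrite mulnS leq_add//; have [] := Hf t.
move=> y [t At]; have [_ /(_ y At)[x xs yx]] := Hf t.
by exists x => //; apply/flattenP; exists (f t) => //; apply: map_f; rewrite mem_enum.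
Qed.

(** Greedy choice: a separated family that cannot be enlarged is itself a net of radius [eta]. *)
Lemma separated_or_coverable (E : set R) eta m :
  (exists s, [/\ size s = m, pairwise (fun u v => eta <= `|u - v|) s &
     forall x, x \in s -> E x]) \/ coverable m eta E.
Proof.
elim: m => [|m [[s [sm ps sE]]|[s [sm sE]]]]; first by left; exists [::].
- have [[y [Ey ys]]|H] := pselect (exists y, E y /\ all (fun v => eta <= `|y - v|) s).
    left; exists (y :: s); split; first by rewrite /= sm.
      by rewrite pairwise_cons ys.
    by move=> x; rewrite inE => /orP[/eqP ->//|]; exact: sE.
  right; exists s; split; first by rewrite sm.
  move=> y Ey; have : ~~ all (fun v => eta <= `|y - v|) s.
    by apply/negP => ys; apply: H; exists y.
  by rewrite -has_predC => /hasP[x xs /=]; rewrite -ltNge => /ltW; exists x.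
- by right; exists s; split => //; exact: leqW.
Qed.

Section FixedScale.
Variables (F : R -> R) (M kappa h : R).
Hypotheses (M0 : 0 <= M) (kappa0 : 0 <= kappa) (h0 : 0 < h) (h1 : 2 * h <= 1).
Hypotheses (hkappa : 2 * h * kappa <= 2^-1) (Fb : divdiff_bounded M kappa h F).

(** Two points of the ball are at distance at most [2 * h], so the remainder in [newton_bound] is at
    most [M * (2 * h * kappa) ^+ size s]. A point [y] that is itself a node is treated apart. *)
Lemma small_on_ball c s eta delta y : 0 < eta <= 1 -> 0 <= delta ->
  pairwise (fun u v => eta <= `|u - v|) s ->
  (forall x, x \in s -> `|x - c| <= h) -> (forall x, x \in s -> `|F x| <= delta) ->
  `|y - c| <= h ->
  `|F y| <= delta * (size s)%:R * (2 / eta) ^+ size s + M * 2^-1 ^+ size s.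
Proof.
move=> /andP[eta0 eta1] d0 ps sc sF yc.
have e2 : 1 <= 2 / eta by rewrite ler_pdivlMr// mul1r (le_trans eta1)// ler1n.
have [ys|ys] := boolP (y \in s).
  apply: le_trans (sF y ys) _; rewrite -[leLHS]addr0; apply: lerD.
    rewrite -mulrA ler_peMr// mulr_ege1 ?exprn_ege1// ler1n.
    by case: (s) ys.
  by rewrite mulr_ge0// exprn_ge0.
have us : uniq (y :: s).
  rewrite /= ys uniq_pairwise; apply: sub_pairwise ps => u v /=.
  by apply: contraTneq => ->; rewrite subrr normr0 -ltNge.
have near x : x \in y :: s -> `|x - c| <= h.
  by rewrite inE => /orP[/eqP->//|]; exact: sc.
apply: le_trans (newton_bound (L := 2 * h) (eta := eta) (delta := delta) _ _ d0 ps ys _ sF) _.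
- by rewrite eta0.
- by rewrite h1 andbT mulr_ge0// ltW.
- move=> u v us' vs'; rewrite (_ : u - v = (u - c) - (v - c)); last by ring.
  by apply: le_trans (ler_normB _ _) _; move: (near u us') (near v vs'); lra.
apply: lerD => //.
apply: (@le_trans _ _ ((2 * h) ^+ size s * (M * kappa ^+ size s))).
  by apply: ler_wpM2l; [rewrite exprn_ge0// mulr_ge0// ltW | exact: Fb us near].
rewrite mulrCA -exprMn; apply: ler_wpM2l => //.
by apply: lerXn2r; rewrite ?nnegrE// !mulr_ge0// ltW.
Qed.

(** Interpolation at more and more equally spaced zeros: with [delta = 0] the growing factor
    [(2 / eta) ^+ size s] is harmless and only the geometric remainder is left. *)
Lemma vanishes_on_ball a c y : `|a - c| <= h -> `|a + h - c| <= h ->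
  (forall x, a <= x <= a + h -> F x = 0) -> `|y - c| <= h -> F y = 0.
Proof.
move=> ac ahc Fa yc; apply/eqP; rewrite -normr_eq0 eq_le normr_ge0 andbT.
suff H m : `|F y| <= geometric (M * 2^-1) 2^-1 m.
  have cv : geometric (M * 2^-1) 2^-1 @ \oo --> (0 : R).
    by apply: cvg_geometric; rewrite ger0_norm// invf_lt1// ltr1n.
  rewrite -(cvg_lim (@Rhausdorff R) cv).
  apply: limr_ge; first by apply/cvg_ex; eexists; exact: cv.
  by apply: nearW => m; exact: H.
rewrite /= -mulrA -exprS; have m0 : 0 < m.+1%:R :> R by [].
pose s := [seq a + h * (i%:R / m.+1%:R) | i <- iota 0 m.+1].
have sz : size s = m.+1 by rewrite size_map size_iota.
have sin x : x \in s -> a <= x <= a + h.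
  move=> /mapP[i]; rewrite mem_iota add0n => /andP[_ im] ->.
  have i0 : 0 <= i%:R / m.+1%:R :> R by rewrite divr_ge0.
  have i1 : i%:R / m.+1%:R <= 1 :> R by rewrite ler_pdivrMr// mul1r ler_nat ltnW.
  by rewrite lerDl lerD2l mulr_ge0 ?(ltW h0)//= ler_piMr// ltW.
have := small_on_ball (c := c) (s := s) (eta := h / m.+1%:R) (delta := 0) (y := y).
rewrite sz !mul0r add0r; apply => //.
- rewrite divr_gt0//= ler_pdivrMr// mul1r (@le_trans _ _ 1)// ?ler1n//.
  by move: h1 (h0); lra.
- rewrite pairwise_map; have := iota_ltn_sorted 0 m.+1.
  rewrite (sorted_pairwise ltn_trans); apply: sub_pairwise => i j /= ij.
  rewrite (_ : _ - _ = - (h / m.+1%:R * (j%:R - i%:R))); last by ring.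
  rewrite normrN -natrB ?(ltnW ij)// normrM ger0_norm ?divr_ge0 ?(ltW h0)//.
  by rewrite ler_peMr ?divr_ge0 ?(ltW h0)// normr_nat ler1n subn_gt0.
- move=> x /sin/andP[ax xa]; rewrite ler_norml; move: ac ahc; rewrite !ler_norml; lra.
- by move=> x /sin/Fa->; rewrite normr0.
Qed.

(** Vanishing spreads from one interval of length [h] to both neighbours, then along all integer
    translates by [h]. *)
Lemma vanishes_everywhere a : (forall x, a <= x <= a + h -> F x = 0) -> forall y, F y = 0.
Proof.
move=> Fa.
have step b : (forall x, b <= x <= b + h -> F x = 0) ->
    (forall x, b + h <= x <= b + h + h -> F x = 0) /\
    (forall x, b - h <= x <= b - h + h -> F x = 0).
  move=> Fb0; split=> x /andP[bx xb];
    [apply: (@vanishes_on_ball b (b + h)) | apply: (@vanishes_on_ball b b)] => //;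
    by rewrite ler_norml; move: h0; lra.
have Z (z : int) x : a + z%:~R * h <= x <= a + z%:~R * h + h -> F x = 0.
  move: x; case: z => n; elim: n => [|n IH].
  - by move=> x; rewrite mul0r addr0; exact: Fa.
  - have [+ _] := step _ IH => H x Hx; apply: H.
    move: Hx; rewrite -!pmulrn -[n.+1%:R]natr1 => /andP[u v]; apply/andP.
    by split; lra.
  - have [_ +] := step _ Fa => H x Hx; apply: H.
    by move: Hx; rewrite NegzE mulN1r.
  - have [_ +] := step _ IH => H x Hx; apply: H.
    move: Hx; rewrite !NegzE !mulrNz -!pmulrn -[n.+2%:R]natr1 => /andP[u v]; apply/andP.
    by split; lra.
move=> y; apply: (Z (Num.floor ((y - a) / h))).
have /andP[] := floor_itv ((y - a) / h).
set z := Num.floor _.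
rewrite ler_pdivlMr// ltr_pdivrMr// intrD mulr1z mulrDl mul1r => ? ?.
by apply/andP; split; lra.
Qed.

(** Otherwise the sublevel set contains [m] points that are [eta]-separated, and interpolating there
    gives a value at most [c / 2] at [y]. *)
Lemma sublevel_coverable a y c c0 m eta : `|y - a| <= h -> 0 < c <= `|F y| ->
  M * 2^-1 ^+ m <= c / 4 -> 0 <= c0 -> c0 * m%:R * 2 ^+ m <= c / 4 -> 0 < eta <= 1 ->
  coverable m eta [set x | a <= x <= a + h /\ `|F x| <= c0 * eta ^+ m].
Proof.
move=> ya /andP[cp cF] Mc c00 c0m eta01; have /andP[eta0 _] := eta01.
set E := [set x | _].
have [[s [sm ps sE]]|//] := separated_or_coverable E eta m.
have := small_on_ball (c := a) (s := s) (y := y) (delta := c0 * eta ^+ m) eta01.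
rewrite sm => H.
have : `|F y| <= c0 * eta ^+ m * m%:R * (2 / eta) ^+ m + M * 2^-1 ^+ m.
  apply: H => //.
  - by rewrite mulr_ge0// exprn_ge0// ltW.
  - by move=> x /sE[/andP[ax xa] _]; rewrite ler_norml; move: h0; lra.
  - by move=> x /sE[].
(* The exponent [m] of the threshold equals the number of nodes, so [eta] cancels. *)
rewrite (_ : c0 * eta ^+ m * m%:R * (2 / eta) ^+ m = c0 * m%:R * 2 ^+ m); last first.
  rewrite exprMn exprVn; field.
  by rewrite expf_neq0// gt_eqF.
by lra.
Qed.

End FixedScale.
End SublevelSets.

(** König's lemma for a property that need not pass to prefixes: the branch follows words [u] having
    extensions that satisfy [P n] for every [n]. *)
Lemma konig (A : finType) (P : nat -> seq A -> Prop) :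
  (forall m n s, (m <= n)%N -> P n s -> P m s) ->
  (forall n, exists2 s, (n <= size s)%N & P n s) ->
  exists f : nat -> A, forall p, exists s,
    [/\ (p <= size s)%N, P p s & take p s = mkseq f p].
Proof.
move=> anti infP.
pose good u := forall n, exists s, [/\ (n <= size s)%N, P n s & take (size u) s = u].
(* A word of length at least 1 supplies a default letter. *)
have [[//|a0 s0] _ _] := infP 1%N.
have /choice[g Hg] : forall u, exists a, good u -> good (rcons u a).
  move=> u; have [gu|] := pselect (good u); last by exists a0.
  apply: contrapT => /forallNP bad.
  (* If every letter failed, each at its own level [N a], an extension of [u] taken at the maximal
     level would contradict the failure of its next letter. *)
  have /choice[N HN] : forall a, exists n, forall s,
      ~ [/\ (n <= size s)%N, P n s & take (size (rcons u a)) s = rcons u a].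
    by move=> a; have /not_implyP[_] := bad a; move=> /existsNP[n /forallNP Hn]; exists n.
  have [s [szs Ps us]] := gu (maxn (size u).+1 (\max_a N a)).
  have su : (size u < size s)%N by apply: leq_trans szs; exact: leq_maxl.
  pose a := nth a0 s (size u).
  have Na : (N a <= maxn (size u).+1 (\max_a N a))%N.
    by rewrite leq_max (leq_bigmax a) orbT.
  apply: (HN a s); split; first exact: leq_trans Na szs.
    exact: anti Na Ps.
  by rewrite size_rcons (take_nth a0 su) us.
pose u n := iter n (fun u => rcons u (g u)) [::].
have uE n : u n = mkseq (g \o u) n by elim: n => [//|n IH]; rewrite mkseqS -IH.
have gu n : good (u n).
  elim: n => [|n IH]; last exact: Hg.
  by move=> n; have [s ? ?] := infP n; exists s; rewrite take0.
exists (g \o u) => p; have [s [ps Ps us]] := gu p p; exists s; split => //.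
by rewrite -uE -[in LHS](size_mkseq (g \o u) p) -uE.
Qed.

(** * The sums S as functions of digit sequences *)

Section WordSums.
Variables (R : realType) (b : nat) (gamma : R) (phi : R -> R).
Hypotheses (b2 : (2 <= b)%N) (gamma0 : 0 < gamma) (gamma1 : gamma < 1).
Implicit Types (x y : R) (d : nat -> nat) (u v w : seq 'I_b).

Let B0 : 0 < b%:R :> R. Proof. by rewrite ltr0n ltnW. Qed.
Let B1 : 1 <= b%:R :> R. Proof. by rewrite ler1n ltnW. Qed.

(** Total digit functions, 0 past the end, let finite words, infinite words and shifted tails share
    the same sums; the length is passed separately. *)
Definition digits v : nat -> nat := nth 0%N (map val v).

Definition digit_value d n : R := \sum_(k < n) (d k)%:R * b%:R ^+ k.

Definition digit_sum d p x :=
  \sum_(n < p) gamma ^+ n * phi ((x + digit_value d n.+1) / b%:R ^+ n.+1).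

Lemma SfinE x v : Sfin gamma phi x v = digit_sum (digits v) (size v) x.
Proof. by rewrite /Sfin big_mkord. Qed.

Lemma digit_value_eq d d' p : (forall k, (k < p)%N -> d k = d' k) ->
  digit_value d p = digit_value d' p.
Proof. by move=> dd; apply: eq_bigr => k _; rewrite dd. Qed.

Lemma digit_sum_eq d d' p x : (forall k, (k < p)%N -> d k = d' k) ->
  digit_sum d p x = digit_sum d' p x.
Proof.
move=> dd; apply: eq_bigr => n _; rewrite (@digit_value_eq d d')// => k kn.
by apply: dd; apply: leq_trans kn _.
Qed.

Lemma digit_valueD d t n :
  digit_value d (t + n) = digit_value d t + b%:R ^+ t * digit_value (fun k => d (t + k)%N) n.
Proof.
rewrite /digit_value big_split_ord /=; congr (_ + _).
by rewrite mulr_sumr; apply: eq_bigr => k _; rewrite exprD; ring.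
Qed.

(** Self-similarity of S: removing a prefix of length [t] rescales the sum by [gamma ^+ t] and the
    variable by [b ^- t]. *)
Lemma digit_sumD d t p x :
  digit_sum d (t + p) x = digit_sum d t x +
    gamma ^+ t * digit_sum (fun k => d (t + k)%N) p ((x + digit_value d t) / b%:R ^+ t).
Proof.
rewrite /digit_sum big_split_ord /=; congr (_ + _).
rewrite mulr_sumr; apply: eq_bigr => n _; rewrite exprD -mulrA; congr (_ * (_ * phi _)).
rewrite -addnS digit_valueD exprD.
have : b%:R ^+ t != 0 :> R by rewrite expf_neq0// gt_eqF.
have : b%:R ^+ n.+1 != 0 :> R by rewrite expf_neq0// gt_eqF.
set p1 := b%:R ^+ n.+1; set p2 := b%:R ^+ t => ? ?.
by field; apply/andP.
Qed.

(** This keeps the rescaled variable [(x + digit_value d t) / b ^+ t] in the unit interval when [x]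
    is there. *)
Lemma digit_value_itv d t : (forall k, (d k < b)%N) ->
  0 <= digit_value d t <= b%:R ^+ t - 1.
Proof.
move=> db; rewrite sumr_ge0/=; last by move=> k _; rewrite mulr_ge0// exprn_ge0// ltW.
elim: t => [|t IH]; first by rewrite /digit_value big_ord0 expr0 subrr.
rewrite /digit_value big_ord_recr /= -/(digit_value d t) exprS.
have dt : (d t)%:R <= b%:R - 1 :> R by rewrite lerBrDr natr1 ler_nat.
have := ler_wpM2r (ltW (exprn_gt0 t B0)) dt.
by clear gamma0 gamma1; move: IH; lra.
Qed.

Section Bounds.
Variables (M kappa e : R).
Hypotheses (M0 : 0 < M) (kappa0 : 0 < kappa) (e0 : 0 < e).
Hypothesis phib : divdiff_bounded M kappa e phi.

(** The case of no nodes in [phib]: a divided difference of order 0 is a value. *)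
Lemma phi_le x : `|phi x| <= M.
Proof.
have := phib (c := x) (s := [::]) (y := x); rewrite /= expr0 mulr1; apply => //.
by move=> z; rewrite inE => /eqP->; rewrite subrr normr0 ltW.
Qed.

Lemma sum_pow_le p : \sum_(n < p) gamma ^+ n <= (1 - gamma)^-1.
Proof.
rewrite -[leRHS]mul1r ler_pdivlMr ?subr_gt0// mulrC -opprB mulNr -subrX1 opprB.
by rewrite gerBl exprn_ge0// ltW.
Qed.

Lemma digit_sum_le d p x : `|digit_sum d p x| <= M / (1 - gamma).
Proof.
apply: le_trans (ler_norm_sum _ _ _) _.
apply: le_trans (ler_wpM2l (ltW M0) (sum_pow_le p)); rewrite mulr_sumr.
apply: ler_sum => n _; rewrite normrM mulrC (ger0_norm (exprn_ge0 n (ltW gamma0))).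
by apply: ler_wpM2r; [rewrite exprn_ge0// ltW | exact: phi_le].
Qed.

(** Each summand is [phi] after an affine contraction, weighted by [gamma ^+ n]; the weights sum to
    at most [1 / (1 - gamma)], whatever the word and its length. *)
Lemma digit_sum_divdiff d p :
  divdiff_bounded (M / (1 - gamma)) kappa e (digit_sum d p).
Proof.
apply: (@divdiff_boundedW _ (M * \sum_(n < p) gamma ^+ n) _ kappa _ e); rewrite ?lexx//.
- rewrite mulr_ge0 ?sumr_ge0 ?(ltW M0)//=; last by move=> n _; rewrite exprn_ge0// ltW.
  by apply: ler_wpM2l; [exact: ltW | exact: sum_pow_le].
- by rewrite ltW.
elim: p => [|p IH].
  rewrite big_ord0 mulr0 (_ : digit_sum d 0 = fun=> 0); first exact: divdiff_bounded0.
  by apply/funext => x; rewrite /digit_sum big_ord0.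
rewrite big_ord_recr mulrDr (_ : digit_sum d p.+1 = digit_sum d p \+ (fun x => gamma ^+ p *
    phi ((b%:R ^+ p.+1)^-1 * x + digit_value d p.+1 / b%:R ^+ p.+1))); last first.
  apply/funext => x; rewrite /digit_sum big_ord_recr /=; congr (_ + _ * phi _).
  by rewrite mulrDl mulrC.
apply: divdiff_boundedD IH _ => /=.
rewrite mulrC -{1}(ger0_norm (ltW (exprn_gt0 p gamma0))).
apply: divdiff_boundedZ; apply: divdiff_bounded_affine phib; rewrite ?(ltW M0) ?(ltW kappa0)//.
by rewrite invr_gt0 exprn_gt0//= invf_le1 ?exprn_gt0// exprn_ege1.
Qed.

Lemma digit_sum_tail d p q x : (p <= q)%N ->
  `|digit_sum d q x - digit_sum d p x| <= gamma ^+ p * (M / (1 - gamma)).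
Proof.
move=> /subnKC <-; rewrite digit_sumD addrC addKr normrM (ger0_norm (exprn_ge0 p (ltW gamma0))).
by apply: ler_wpM2l; [rewrite exprn_ge0// ltW | exact: digit_sum_le].
Qed.

Lemma Sinf_cvg x (j : nat -> 'I_b) :
  digit_sum (val \o j) p x @[p --> \oo] --> Sinf gamma phi x j.
Proof.
have -> : (fun p => digit_sum (val \o j) p x) = series (Sterm gamma phi x j).
  by apply/funext => p; rewrite /series /= big_mkord.
apply: (@normed_cvg R R (Sterm gamma phi x j)).
apply: (@series_le_cvg _ _ (geometric M gamma)).
- by move=> n /=.
- by move=> n /=; rewrite mulr_ge0 ?exprn_ge0// ltW.
- move=> n /=; rewrite normrM mulrC (ger0_norm (exprn_ge0 n (ltW gamma0))).
  by apply: ler_wpM2r; [rewrite exprn_ge0// ltW | exact: phi_le].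
- by apply: is_cvg_geometric_series; rewrite gtr0_norm.
Qed.

End Bounds.
End WordSums.

(** * Quantitative transversality from condition (H) *)

Section Transversality.
Variables (R : realType) (b : nat) (gamma : R) (phi : R -> R) (M kappa h : R).
Hypotheses (b2 : (2 <= b)%N) (gamma0 : 0 < gamma) (gamma1 : gamma < 1).
Hypotheses (M0 : 0 < M) (kappa0 : 0 < kappa) (h0 : 0 < h) (h1 : 2 * h <= 1).
Hypotheses (hkappa : 2 * h * kappa <= 2^-1) (phib : divdiff_bounded M kappa h phi).
Hypothesis phiH : condH b gamma phi.
Implicit Types (a x y : R) (v w : seq 'I_b).

Local Notation D := (digit_sum b gamma phi).

Let C := M / (1 - gamma).

Let C0 : 0 < C. Proof. by rewrite divr_gt0// subr_gt0. Qed.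

Let C20 : 0 <= 2 * C. Proof. by rewrite mulr_ge0// ltW. Qed.

Lemma digit_sumB_divdiff d d' p :
  divdiff_bounded (2 * C) kappa h (fun x => D d p x - D d' p x).
Proof.
have H e := digit_sum_divdiff b2 gamma0 gamma1 M0 kappa0 phib e p.
rewrite (_ : (fun x => _) = D d p \+ (fun x => (-1) * D d' p x)).
  rewrite [2 * C]mulr_natl mulr2n; apply: divdiff_boundedD => //.
  by have := divdiff_boundedZ (-1) (H d'); rewrite normrN1 mul1r.
by apply/funext => x /=; rewrite mulN1r.
Qed.

Lemma digits_take (A : finType) (g : A -> 'I_b) (f : nat -> A) (s : seq A) p k :
  take p s = mkseq f p -> (k < p)%N -> digits (map g s) k = g (f k) :> nat.
Proof.
move=> sf kp; rewrite /digits -map_comp -(nth_take _ kp) -map_take sf /mkseq -map_comp.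
by rewrite (nth_map 0%N) ?size_iota// nth_iota.
Qed.

Lemma digit_sum_prefix d d' p q x : (p <= q)%N -> (forall k, (k < p)%N -> d k = d' k) ->
  `|D d q x - D d' p x| <= gamma ^+ p * C.
Proof.
move=> pq dd; rewrite -(@digit_sum_eq R b gamma phi d d' p x dd).
exact: (digit_sum_tail b2 gamma0 gamma1 M0 h0 phib d x pq).
Qed.

(* Compactness of the space of pairs of words: a sequence of ever smaller
   differences would produce two infinite words violating (H). *)
Lemma uniform_nondegeneracy a : exists N, forall v v', size v = size v' ->
  (N <= size v)%N -> digits v 0 <> digits v' 0 ->
  exists2 y, a <= y <= a + h & N.+1%:R^-1 <= `|Sfin gamma phi y v - Sfin gamma phi y v'|.
Proof.
apply: contrapT => /forallNP bad.
(* Two words of equal length become one word over pairs of letters, so that a single use of [konig]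
   extracts both limits. *)
pose P n (s : seq ('I_b * 'I_b)) := digits (map fst s) 0 <> digits (map snd s) 0 /\
  forall y, a <= y <= a + h ->
    `|Sfin gamma phi y (map fst s) - Sfin gamma phi y (map snd s)| <= n.+1%:R^-1.
have anti m n s : (m <= n)%N -> P n s -> P m s.
  move=> mn [s0 Ps]; split => // y /Ps /le_trans; apply.
  by rewrite lef_pV2 ?posrE// ler_nat.
have infP n : exists2 s, (n <= size s)%N & P n s.
  have /existsNP[v /existsNP[v' /not_implyP[vv /not_implyP[nv /not_implyP[v0 Hv]]]]] := bad n.
  exists (zip v v'); first by rewrite size_zip -vv minnn.
  rewrite /P -/(unzip1 _) -/(unzip2 _) unzip1_zip ?vv// unzip2_zip ?vv//; split => // y ya.
  by rewrite leNgt; apply/negP => lt; apply: Hv; exists y => //; exact: ltW.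
have [f Hf] := konig anti infP.
pose i := fst \o f; pose j := snd \o f.
apply: (phiH (i := i) (j := j)).
  (* A prefix of length 1 already shows that the limit words differ in their first letter. *)
  have [s [_ [s0 _] sf]] := Hf 1%N.
  move: s0; rewrite !(digits_take _ sf)// => ne ij; apply: ne.
  by have /(congr1 (fun g => val (g 0%N))) := ij.
have cvgS (k : nat -> 'I_b) x : D (val \o k) p x @[p --> \oo] --> Sinf gamma phi x k.
  exact: (Sinf_cvg gamma0 gamma1 M0 h0 phib).
have cvg_diff x : D (val \o j) p x - D (val \o i) p x @[p --> \oo]
    --> Sinf gamma phi x j - Sinf gamma phi x i by exact: cvgB.
have Db : divdiff_bounded (2 * C) kappa h (fun x => Sinf gamma phi x j - Sinf gamma phi x i).
  by apply: divdiff_bounded_cvg cvg_diff => p; exact: digit_sumB_divdiff.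
(* The limit difference is only controlled on the interval starting at [a]; interpolation carries
   its vanishing to the whole line. *)
move=> x _; move: x; apply: (vanishes_everywhere C20 (ltW kappa0) h0 h1 hkappa Db (a := a)).
move=> x xa; apply/eqP; rewrite -normr_eq0 eq_le normr_ge0 andbT.
(* The geometric term bounds the two truncation errors, the harmonic one comes from [P p]. *)
have cvg0 : geometric (2 * C) gamma p + harmonic p @[p --> \oo] --> 0 + (0 : R).
  by apply: cvgD; [apply: cvg_geometric; rewrite gtr0_norm | exact: cvg_harmonic].
rewrite addr0 in cvg0; have /cvg_norm cvgN := cvg_diff x.
apply: (ler_cvg_to cvgN cvg0); apply: nearW => p /=.
have [s [ps [_ Ps] sf]] := Hf p; have {}Ps := Ps x xa.
have Hi := digit_sum_prefix (d := digits (map fst s)) (d' := val \o i) x ps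
  (fun k kp => digits_take fst sf kp).
have Hj := digit_sum_prefix (d := digits (map snd s)) (d' := val \o j) x ps
  (fun k kp => digits_take snd sf kp).
rewrite !SfinE !size_map in Ps.
rewrite (_ : 2 * C * gamma ^+ p = gamma ^+ p * C + gamma ^+ p * C); last by ring.
move: Hi Hj Ps; set t := _ * C.
set A := D _ (size s) x; set A' := D _ (size s) x; set B := D _ p x; set B' := D _ p x.
by rewrite !ler_norml; set q := _^-1; lra.
Qed.

(** The unit interval is cut into pieces of length [h], and [sublevel_coverable] applies on each.
    Constants are chosen in the order [N], [c], [m], [c0], all before the words and [eta]. *)
Lemma transversality : exists (c0 : R) (m K N : nat), 0 < c0 <= 1 /\
  forall v v', size v = size v' -> (N <= size v)%N -> digits v 0 <> digits v' 0 ->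
  forall eta, 0 < eta <= 1 -> coverable K eta
    [set x | 0 <= x <= 1 /\ `|Sfin gamma phi x v - Sfin gamma phi x v'| <= c0 * eta ^+ m].
Proof.
pose K0 := Num.bound h^-1.
have /choice[n Hn] := fun k : 'I_K0 => uniform_nondegeneracy (k%:R * h).
pose N := (\max_k n k)%N.
pose c : R := N.+1%:R^-1.
have c_gt0 : 0 < c by rewrite invr_gt0.
have c_le1 : c <= 1 by rewrite invf_le1// ler1n.
have [m Hm] : exists m, 2 * C * 2^-1 ^+ m <= c / 4.
  have /cvgrPdist_le H : geometric (2 * C) 2^-1 @ \oo --> (0 : R).
    by apply: cvg_geometric; rewrite ger0_norm// invf_lt1// ltr1n.
  have [|m _ /(_ m (leqnn m)) /=] := H (c / 4); first by rewrite divr_gt0.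
  by rewrite sub0r normrN => /(le_trans (ler_norm _)); exists m.
(* [m.+1] instead of [m] keeps the denominator positive when [m] is 0. *)
pose den : R := m.+1%:R * 2 ^+ m.
have den1 : 1 <= den by rewrite mulr_ege1 ?ler1n// exprn_ege1// ler1n.
have den0 : 0 < den by apply: lt_le_trans den1.
exists (c / 4 / den), m, (m * #|'I_K0|)%N, N; split.
  by rewrite divr_gt0 ?divr_gt0//= ler_pdivrMr//; lra.
move=> v v' vv Nv v0 eta eta01.
have cov (k : 'I_K0) : coverable m eta [set x | k%:R * h <= x <= k%:R * h + h /\
    `|Sfin gamma phi x v - Sfin gamma phi x v'| <= c / 4 / den * eta ^+ m].
  have nN : (n k <= N)%N by exact: leq_bigmax.
  have [y /andP[ay ya] Hy] := Hn k v v' vv (leq_trans nN Nv) v0.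
  have E x : Sfin gamma phi x v - Sfin gamma phi x v' =
      D (digits v) (size v) x - D (digits v') (size v) x.
    by rewrite !SfinE vv.
  have Fb : divdiff_bounded (2 * C) kappa h
      (fun x => Sfin gamma phi x v - Sfin gamma phi x v').
    rewrite (_ : (fun x => _) = (fun x => D (digits v) (size v) x - D (digits v') (size v) x)).
      exact: digit_sumB_divdiff.
    exact/funext.
  apply: (sublevel_coverable C20 (ltW kappa0) h0 h1 hkappa Fb (y := y) (c := c)) => //.
  - by rewrite ler_norml; move: h0; lra.
  - by rewrite c_gt0/=; apply: le_trans Hy; rewrite lef_pV2 ?posrE// ler_nat.
  - by rewrite divr_ge0 ?divr_ge0// ltW.
  - rewrite -mulrA -[leRHS](divfK (lt0r_neq0 den0)).
    apply: ler_wpM2l; first by rewrite divr_ge0 ?divr_ge0// ltW.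
    by apply: ler_wpM2r; rewrite ?ler_nat// exprn_ge0.
have [s [szs Hs]] := coverable_bigcup cov.
exists s; split => // x [/andP[x0 x1] Hx]; apply: Hs.
have xh0 : 0 <= x / h by rewrite divr_ge0// ltW.
have /andP[t1 t2] := truncn_itv xh0.
have tK : (Num.trunc (x / h) < K0)%N.
  rewrite -(ltr_nat R); apply: le_lt_trans t1 _.
  apply: le_lt_trans (archi_boundP _); last by rewrite invr_ge0 ltW.
  by rewrite ler_piMl// invr_ge0 ltW.
exists (Ordinal tK) => /=; split => //.
have hn0 : h != 0 by rewrite gt_eqF.
apply/andP; split; first by rewrite -ler_pdivlMr.
by move: t2; rewrite ltr_pdivrMr// -natr1 mulrDl mul1r => /ltW.
Qed.

End Transversality.

(** * Borel-Cantelli for coverable sets *)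

Section BorelCantelli.
Variable R : realType.
Local Notation mu := (@lebesgue_measure R).

Definition balls (s : seq R) (eta : R) : set R :=
  \big[setU/set0]_(c <- s) [set` `[c - eta, c + eta]].

Lemma measure_balls_le (s : seq R) eta : 0 <= eta ->
  measurable (balls s eta) /\ (mu (balls s eta) <= ((size s)%:R * (2 * eta))%:E)%E.
Proof.
rewrite /balls => eta0; elim: s => [|c s [mIH IH]]; first by rewrite big_nil measure0 mul0r.
rewrite big_cons; split; first exact: measurableU.
apply: le_trans (measureU2 _ _ _) _ => //=.
rewrite -natr1 mulrDl mul1r addrC EFinD; apply: leeD => //.
rewrite lebesgue_measure_itv /=; case: ifP => _; last by rewrite lee_fin mulr_ge0.
by rewrite -EFinB lee_fin; lra.
Qed.

(** The sets [A n] are not assumed measurable; Borel-Cantelli is applied to the unions of intervals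
    covering them. *)
Lemma lim_sup_coverable_negligible (A : nat -> set R) (k : nat -> nat) (eta : nat -> R) C :
  (forall n, 0 <= eta n) -> 0 <= C ->
  (forall n, coverable (k n) (eta n) (A n)) ->
  (forall n, (k n)%:R * (2 * eta n) <= C / 2 ^+ n) ->
  mu.-negligible (lim_sup_set A).
Proof.
move=> eta0 C0 /choice[s Hs] kC.
pose U n := balls (s n) (eta n).
exists (lim_sup_set U); split.
- apply: bigcap_measurable => // n _; apply: bigcup_measurable => i _.
  by have [] := measure_balls_le (s i) (eta0 i).
- apply: lim_sup_set_cvg0; first by move=> n; have [] := measure_balls_le (s n) (eta0 n).
  apply: (@le_lt_trans _ _ (2 * C)%:E); last exact: ltry.
  (* The library series has terms [eps / 2 ^ n.+1], whence [2 * C]. *)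
  apply: le_trans (epsilon_trick0 xpredT _); last by rewrite mulr_ge0.
  apply: lee_nneseries => [n _ _|n _]; first exact: measure_ge0.
  have [_ H] := measure_balls_le (s n) (eta0 n).
  apply: le_trans H _; rewrite lee_fin.
  apply: le_trans (le_trans _ (kC n)) _.
    apply: ler_wpM2r; first by rewrite mulr_ge0.
    by rewrite ler_nat; have [] := Hs n.
  by rewrite natrX exprS invfM mulrACA divff// mul1r.
- move=> x Ax n nn; have [i ni Ai] := Ax n nn; exists i => //.
  have [_ /(_ x Ai)[c cs xc]] := Hs i.
  rewrite /U /balls -bigcup_seq; exists c => //=.
  by rewrite in_itv /=; move: xc; rewrite ler_norml; lra.
Qed.

End BorelCantelli.

(** * Covering the points x where two sums are too close *)

Section Separation.
Variables (R : realType) (b : nat) (gamma : R) (phi : R -> R).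
Hypotheses (b2 : (2 <= b)%N) (gamma0 : 0 < gamma) (gamma1 : gamma < 1).
Variables (c0 : R) (m K l0 : nat).
Hypothesis c01 : 0 < c0 <= 1.
Hypothesis trans : forall v v' : seq 'I_b, size v = size v' -> (l0 <= size v)%N ->
  digits v 0 <> digits v' 0 -> forall eta, 0 < eta <= 1 -> coverable K eta
    [set x | 0 <= x <= 1 /\ `|Sfin gamma phi x v - Sfin gamma phi x v'| <= c0 * eta ^+ m].

Let B0 : 0 < b%:R :> R. Proof. by rewrite ltr0n ltnW. Qed.
Let B1 : 1 <= b%:R :> R. Proof. by rewrite ler1n ltnW. Qed.

(* The power [b ^+ 3] pays for the [b ^ (2 N)] pairs of words and for the
   expansion [b ^+ N] of the change of variables. *)
Let theta := gamma / b%:R ^+ 3.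
(** For [t <= N] and [0 < N], [eps ^+ N] is at most [gamma ^+ t] times [c0 * (theta ^+ N) ^+ m], the
    threshold of [trans] at scale [theta ^+ N]. *)
Let eps := gamma * c0 * theta ^+ m.

Let theta0 : 0 < theta. Proof. by rewrite divr_gt0// exprn_gt0. Qed.

Let theta1 : theta <= 1.
Proof.
rewrite ler_pdivrMr ?exprn_gt0// mul1r (le_trans (ltW gamma1))// exprn_ege1//.
Qed.

(** The common prefix up to the first difference [t] cancels, [trans] applies to the remaining
    words, and pulling back along [x] to [(x + U) / b ^+ t] enlarges radii by [b ^+ t <= b ^+ N]. *)
Lemma pair_coverable l N (v v' : seq 'I_b) : (l0 <= l < N)%N -> size v = N -> size v' = N ->
  drop (N - l) v = drop (N - l) v' -> v != v' ->
  coverable K ((b%:R * theta) ^+ N)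
    [set x | 0 <= x <= 1 /\ `|Sfin gamma phi x v - Sfin gamma phi x v'| <= eps ^+ N].
Proof.
move=> /andP[l0l lN] sv sv' dvv vv'.
have /ex_minnP[t tne tmin] : exists t, digits v t != digits v' t.
  apply: contrapT => /forallNP H; move/negP: vv'; apply; apply/eqP.
  apply: (inj_map val_inj); apply: (@eq_from_nth _ 0%N); rewrite ?size_map ?sv ?sv'// => i _.
  by apply/eqP/negPn/negP; exact: H.
have tlt k : (k < t)%N -> digits v k = digits v' k.
  by move=> kt; apply/eqP; apply: contraTT kt => /tmin; rewrite -leqNgt.
(* The last [l] letters agree, so the words left after dropping [t] letters have length above [l],
   hence at least [l0]. *)
have tN : (t < N - l)%N.
  rewrite ltnNge; apply/negP => Nt; move/negP: tne; apply; apply/eqP.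
  by rewrite /digits -(subnKC Nt) -!nth_drop -!map_drop dvv.
have dig (u : seq 'I_b) k : digits (drop t u) k = digits u (t + k).
  by rewrite /digits map_drop nth_drop.
have b_gt0 : (0 < b)%N by exact: ltnW.
have tN' : (t <= N)%N by apply: ltnW (leq_trans tN (leq_subr _ _)).
have l0t : (l0 <= N - t)%N by clear -l0l lN tN; lia.
have N0 : (0 < N)%N by clear -lN; lia.
have Nt : (t + (N - t) = N)%N by exact: subnKC.
pose U : R := digit_value R b (digits v) t.
have SE (u : seq 'I_b) x : size u = N -> digit_value R b (digits u) t = U ->
    Sfin gamma phi x u = digit_sum b gamma phi (digits u) t x +
      gamma ^+ t * Sfin gamma phi ((x + U) / b%:R ^+ t) (drop t u).
  move=> su uU; rewrite !SfinE su -{1}Nt digit_sumD// uU size_drop su.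
  by congr (_ + _ * _); apply: digit_sum_eq => k _; rewrite dig.
have bt0 : 0 < b%:R ^+ t :> R by rewrite exprn_gt0.
have btN : b%:R ^+ t <= b%:R ^+ N :> R by rewrite ler_weXn2l.
have thN : 0 < theta ^+ N <= 1 by rewrite exprn_gt0//= exprn_ile1// ltW.
have [||| s [szs Hs]] := trans (v := drop t v) (v' := drop t v') _ _ _ thN.
- by rewrite !size_drop sv sv'.
- by rewrite size_drop sv.
- by rewrite !dig addn0; apply/eqP.
exists [seq b%:R ^+ t * c - U | c <- s]; split; first by rewrite size_map.
move=> x [/andP[x0 x1] Hx].
have db k : (digits v k < b)%N.
  rewrite /digits; have [kv|kv] := ltnP k (size v).
    by case: (v) kv => // a v0 kv; rewrite (nth_map a)// ltn_ord.
  by rewrite nth_default ?size_map.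
have /andP[U0 U1] : 0 <= U <= b%:R ^+ t - 1 by exact: (digit_value_itv R b2).
have [|c cs Hc] := Hs ((x + U) / b%:R ^+ t).
  split.
    apply/andP; split; first by rewrite divr_ge0 ?addr_ge0// ltW.
    by rewrite ler_pdivrMr// mul1r; move: U1; rewrite -/U; lra.
  have U' : digit_value R b (digits v') t = U by apply: digit_value_eq => k /tlt.
  move: Hx; rewrite (SE v)// (SE v')// (@digit_sum_eq R b gamma phi (digits v) (digits v'))//.
  rewrite opprD addrACA subrr add0r -mulrBr normrM normrX (gtr0_norm gamma0).
  set F := `|_| => HF.
  have gN : gamma ^+ N <= gamma ^+ t by rewrite ler_wiXn2l// ltW.
  have : gamma ^+ N * F <= eps ^+ N by apply: le_trans HF; apply: ler_wpM2r gN; rewrite /F.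
  rewrite /eps -mulrA exprMn ler_pM2l ?exprn_gt0// => /le_trans; apply.
  rewrite exprMn -exprM mulnC exprM; apply: ler_wpM2r; first by rewrite exprn_ge0// exprn_ge0// ltW.
  have /andP[c00 c0l1] := c01.
  by rewrite -{2}[c0]expr1 ler_wiXn2l ?(ltW c00).
exists (b%:R ^+ t * c - U); first exact: map_f.
rewrite (_ : x - _ = b%:R ^+ t * ((x + U) / b%:R ^+ t - c)); last first.
  by rewrite mulrBr mulrCA divff ?gt_eqF// mulr1; ring.
rewrite normrM (gtr0_norm bt0) exprMn; by apply: ler_pM.
Qed.

(** A union over two prefixes and one suffix, that is [b ^ (2 * N - l)] triples; for [N <= l] the
    set is empty, since [Xset] is then a single point. *)
Lemma Xset_coverable l N : (l0 <= l)%N -> coverable (K * b ^ (2 * N)) ((b%:R * theta) ^+ N)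
  [set x | 0 <= x <= 1 /\ exists w : seq 'I_b, size w = l /\ exists p q,
    [/\ Xset gamma phi l w x N p, Xset gamma phi l w x N q, p <> q & `|p - q| <= eps ^+ N]].
Proof.
move=> l0l; have [lN|Nl] := ltnP l N; last first.
  exists [::]; split=> // x [_ [w [_ [p [q [+ + + _]]]]]].
  by rewrite /Xset ltnNge Nl /= => -> ->.
pose T := ((N - l).-tuple 'I_b * (N - l).-tuple 'I_b * l.-tuple 'I_b)%type.
pose A (t : T) : set R := [set x | t.1.1 ++ t.2 != t.1.2 ++ t.2 /\ (0 <= x <= 1 /\
  `|Sfin gamma phi x (t.1.1 ++ t.2) - Sfin gamma phi x (t.1.2 ++ t.2)| <= eps ^+ N)].
have cov (t : T) : coverable K ((b%:R * theta) ^+ N) (A t).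
  rewrite /A; have [E|ne] := eqVneq (t.1.1 ++ t.2 : seq 'I_b) (t.1.2 ++ t.2).
    by exists [::]; split => // y [].
  have [|||| s [szs Hs]] := pair_coverable (l := l) (N := N) _ _ _ _ ne.
  - by rewrite l0l.
  - by rewrite size_cat !size_tuple subnK// ltnW.
  - by rewrite size_cat !size_tuple subnK// ltnW.
  - by rewrite !drop_size_cat ?size_tuple.
  by exists s; split => // y [_ /Hs].
have [s [szs Hs]] := coverable_bigcup cov.
exists s; split.
  apply: leq_trans szs _; rewrite leq_mul2l !card_prod !card_tuple !card_ord -!expnD.
  apply/orP; right; rewrite leq_pexp2l ?(ltnW b2)//.
  by clear -lN; lia.
move=> x [x01 [w [sw [p [q [+ + pq pqe]]]]]].
rewrite /Xset lN => -[j [sj pE]] [j' [sj' qE]]; apply: Hs.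
exists (Tuple (introT eqP sj), Tuple (introT eqP sj'), Tuple (introT eqP sw)); split => /=.
  by apply: contra_notN pq => /eqP jj; rewrite pE qE jj.
by rewrite -pE -qE.
Qed.

End Separation.

(** * Choice of parameters and passage to almost every x *)

Unset Implicit Arguments.

Theorem theorem4p2 (R : realType) (b : nat) (gamma : R) (phi : R -> R)
  (hb : (2 <= b)%N) (hg0 : 0 < gamma) (hg1 : gamma < 1)
  (han : real_analytic phi) (hper : Zperiodic phi) (hH : condH b gamma phi)
  (hat : nat -> nat)
  (hhat : forall n : nat,
     gamma ^+ hat n <= (b%:R : R) ^- n /\ (b%:R : R) ^- n < gamma ^ ((hat n)%:Z - 1)) :
  exists (l0 : nat) (eps0 : R), 0 < eps0 /\
    (@lebesgue_measure R).-negligible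
      [set x : R | 0 <= x <= 1 /\
        ~ (forall l : nat, (l0 <= l)%N ->
             exists Q : set nat,
               Q `<=` [set n | (0 < n)%N] /\
               infinite_set Q /\
               (forall (w : seq 'I_b) (n : nat), size w = l -> Q n ->
                  forall p q : R,
                    Xset gamma phi l w x (hat n) p ->
                    Xset gamma phi l w x (hat n) q ->
                    p <> q -> eps0 ^+ hat n < `|p - q|))].
Proof.
have [M [kappa [e [M0 kappa0 e0 phib]]]] := analytic_divdiff_bounded han hper.
pose h := Num.min e (Num.min 2^-1 (4 * kappa)^-1).
have k4 : 0 < (4 * kappa)^-1 by rewrite invr_gt0 mulr_gt0.
have h0 : 0 < h by rewrite !lt_min e0 k4 invr_gt0 ltr0n.
have he : h <= e by rewrite ge_min lexx.
have h1 : 2 * h <= 1.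
  have : h <= 2^-1 by rewrite !ge_min lexx orbT.
  by lra.
have hkappa : 2 * h * kappa <= 2^-1.
  have : h <= (4 * kappa)^-1 by rewrite !ge_min lexx !orbT.
  rewrite -[_^-1]mul1r ler_pdivlMr ?mulr_gt0// => H.
  by move: H; rewrite mulrCA -mulrA; lra.
have phibh : divdiff_bounded M kappa h phi.
  by apply: divdiff_boundedW phib; rewrite ?lexx ?andbT ?(ltW M0) ?(ltW kappa0).
have [c0 [m [K [l0 [c01 trans]]]]] :=
  transversality hb hg0 hg1 M0 kappa0 h0 h1 hkappa phibh hH.
have b0 : 0 < b%:R :> R by rewrite ltr0n ltnW.
have /andP[c00 _] := c01.
pose theta : R := gamma / b%:R ^+ 3.
have theta0 : 0 < theta by rewrite divr_gt0// exprn_gt0.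
pose eps := gamma * c0 * theta ^+ m.
exists l0, eps; split; first by rewrite !mulr_gt0// exprn_gt0.
(* Setting [A l n] to be empty for [l < l0] lets the countable union run over all [l]. *)
pose A l n : set R := if (l0 <= l)%N then [set x | 0 <= x <= 1 /\
  exists w : seq 'I_b, size w = l /\ exists p q, [/\ Xset gamma phi l w x (hat n) p,
    Xset gamma phi l w x (hat n) q, p <> q & `|p - q| <= eps ^+ hat n]] else set0.
have negl : (@lebesgue_measure R).-negligible (\bigcup_l lim_sup_set (A l)).
  apply: negligible_bigcup => l.
  apply: (@lim_sup_coverable_negligible _ _ (fun n => (K * b ^ (2 * hat n))%N)
    (fun n => (b%:R * theta) ^+ hat n) (2 * K%:R)).
  - by move=> n; rewrite exprn_ge0// mulr_ge0// ltW.
  - by rewrite mulr_ge0.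
  - move=> n; rewrite /A; case: ifP => l0l.
      exact: (Xset_coverable hb hg0 hg1 c01 trans).
    by exists [::].
  - move=> n; have [gn _] := hhat n.
    rewrite natrM natrX exprM.
    (* Since [b ^+ 3 * theta = gamma], the total length is [2 * K * gamma ^+ hat n], at most
       [2 * K / b ^+ n] by the choice of [hat n]. *)
    rewrite (_ : K%:R * _ * _ = 2 * K%:R * (b%:R ^+ 2 * (b%:R * theta)) ^+ hat n); last first.
      by rewrite [in RHS]exprMn; ring.
    rewrite (_ : b%:R ^+ 2 * _ = gamma); last first.
      by rewrite mulrA -exprSr mulrC divfK// expf_neq0// gt_eqF.
    apply: ler_wpM2l; first by rewrite mulr_ge0.
    apply: le_trans gn _; rewrite lef_pV2 ?posrE ?exprn_gt0//.
    by apply: lerXn2r; rewrite ?nnegrE ?ler_nat// ltW.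
apply: negligibleS negl => x [x01 bad]; apply: contrapT => nlim; apply: bad => l l0l.
have {nlim} [n0 Hn0] : exists n0, forall n, (n0 <= n)%N -> ~ A l n x.
  apply: contrapT => /forallNP H; apply: nlim; exists l => // n _.
  have /existsNP[i /not_implyP[ni /contrapT Ai]] := H n.
  by exists i.
(* All but finitely many [n] belong to this set, because [x] lies outside the upper limit of
   [A l]. *)
exists [set n | (0 < n)%N /\ ~ A l n x]; split; first by move=> n [].
split.
  move=> fin; apply: infinite_nat.
  apply: (@sub_finite_set _ _ ([set n | (0 < n)%N /\ ~ A l n x] `|` `I_(maxn n0 1))).
    move=> n _; have [nn0|nn0] := ltnP n (maxn n0 1); first by right.
    left; move: nn0; rewrite geq_max => /andP[nn0 n_gt0]; split => //.
    exact: Hn0.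
  by rewrite finite_setU; split => //; exact: finite_II.
move=> w n sw [_ nA] p q Xp Xq pq; rewrite ltNge; apply/negP => le.
by apply: nA; rewrite /A l0l; split => //; exists w; split => //; exists p, q.
Qed.
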